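(* Consider instances consisting of a finite strongly connected directed graph $G$ on $n$ nodes with transition matrix $H$, on which the pull voter model with agnostic nodes (either synchronous or asynchronous, gnostic colours red and blue) always converges, together with an initial configuration $S_0$ having at least one red node. Assume that $1/p$ is bounded by a polynomial in $n$, where $p$ is the smallest non-zero entry of $H$. Let $c$ be the probability of red consensus from $S_0$. Let $\omega(n)$ be an arbitrarily slowly growing function with $\omega(n)\to\infty$. Then for every $\varepsilon>0$, the Monte Carlo algorithm described in the context, for estimating $c$, provides an estimate $\bar c$ which, with high probability (probability tending to $1$ as $n\to\infty$), satisfies $$(1-\varepsilon)c\le \bar c\le (1+\varepsilon)c ,$$ by performing at most $$k=\frac{2\,\omega(n)}{\varepsilon^2c^2}$$ repetitions (rounded up to an integer), and with total running time polynomial (in $n$, $1/\varepsilon$ and $\omega(n)$).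
   Context: Setting. $G=(V,E)$ is a finite strongly connected directed graph (self-loops allowed). The transition matrix $H$ is a row-stochastic $V\times V$ matrix with $H(v,u)>0$ if $(v,u)\in E$ and $H(v,u)=0$ otherwise; $\mu$ is its stationary distribution ($\mu H=\mu$, $\sum_v\mu(v)=1$). Pull voter model with agnostic nodes. Each node is, at each time, either agnostic (no colour) or gnostic; gnostic nodes are coloured red or blue. In the synchronous version, at each round every node $v$ independently selects an out-neighbour $u$ with probability $H(v,u)$. If $u$ is agnostic, $v$ keeps its current state; if $u$ is gnostic, $v$ copies the colour of $u$. All updates use the states at the start of the round and occur simultaneously. In the asynchronous version, at each round one node $v$ is chosen uniformly at random from $V$, it alone selects an out-neighbour (with probabilities $H(v,\cdot)$) and updates by the same rule; all other nodes keep their state. Red consensus means that all nodes become red. The process always converges on $G$ if, from every initial configuration with at least one gnostic node, with probability 1 a configuration in which all nodes have the same gnostic colour is eventually reached. Monte Carlo algorithm. One repetition (run): simulate the process from $S_0$ until all nodes are gnostic, and output $\sum_{v\text{ red}}\mu(v)$, the sum over the nodes that are red at that moment (this is the probability of red consensus conditional on that configuration). The estimate $\bar c$ is the average of the outputs of the independent repetitions.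
   Formalization: The total running time is bounded, with high probability, by a polynomial in n, 1/ε and ω(n) times 1/c², not by such a polynomial alone: c can be exponentially small, and then no polynomial number of repetitions gives the claimed estimate. *)

(* Defs.v *)
From mathcomp Require Import all_boot all_order all_algebra.
From mathcomp Require Import all_classical all_reals all_analysis.

Set Implicit Arguments.
Unset Strict Implicit.
Unset Printing Implicit Defensive.
Import Order.TTheory GRing.Theory Num.Theory.
Local Open Scope classical_set_scope.
Local Open Scope ring_scope.

(** ** Instances *)

Definition strongly_connected (n : nat) (E : rel 'I_n) : Prop :=
  forall v u : 'I_n, connect E v u.

Definition transition_matrix (R : realType) (n : nat) (E : rel 'I_n)
    (H : 'M[R]_n) : Prop :=
  (forall v u, (E v u -> 0 < H v u) /\ (~~ E v u -> H v u = 0)) /\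
  (forall v, \sum_u H v u = 1).

Definition stationary_distribution (R : realType) (n : nat) (H : 'M[R]_n)
    (mu : 'rV[R]_n) : Prop :=
  [/\ forall v, 0 <= mu 0 v, \sum_v mu 0 v = 1 & mu *m H = mu].

Definition smallest_nonzero_entry (R : realType) (n : nat) (H : 'M[R]_n)
    (p : R) : Prop :=
  [/\ p != 0, exists v u, H v u = p
    & forall v u, H v u != 0 -> p <= H v u].

(** ** The pull voter model with agnostic nodes *)

Inductive update_mode := Synchronous | Asynchronous.

(* [None] is agnostic, [Some c] is gnostic of colour [c]. *)
Definition node_state : Type := option bool.
Definition red : node_state := Some true.
Definition blue : node_state := Some false.
Definition gnostic (s : node_state) : bool := isSome s.

Definition config (n : nat) : Type := {ffun 'I_n -> node_state}.

Definition all_gnostic (n : nat) (s : config n) : bool :=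
  [forall v, gnostic (s v)].

Definition consensus (n : nat) (x : node_state) (s : config n) : bool :=
  [forall v, s v == x].

(* State of [v] after it has selected the out-neighbour [u]. *)
Definition pull (n : nat) (s : config n) (v u : 'I_n) : node_state :=
  if gnostic (s u) then s u else s v.

(* The randomness of one round is a function [x] on [option 'I_n]:
   [x (Some v)] is the out-neighbour selected by [v] if [v] updates, and
   [x None] is the node activated in an asynchronous round.  The values that
   a mode does not use are drawn but ignored. *)
Definition step (n : nat) (m : update_mode) (s : config n)
    (x : option 'I_n -> 'I_n) : config n :=
  match m with
  | Synchronous => [ffun v => pull s v (x (Some v))]
  | Asynchronous =>
      [ffun v => if v == x None then pull s v (x (Some v)) else s v]
  end.

Fixpoint trajectory (n : nat) (m : update_mode) (s0 : config n)
    (x : nat -> option 'I_n -> 'I_n) (t : nat) : config n :=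
  if t is t'.+1 then step m (trajectory m s0 x t') (x t') else s0.

(** ** Randomness *)

Definition draw_law (R : realType) (n : nat) (H : 'M[R]_n) (i : option 'I_n)
    (u : 'I_n) : R :=
  if i is Some v then H v u else n%:R^-1.

(* [X (j, t, i)] is the draw [i] of round [t] of repetition [j]. *)
Definition independent_draws (R : realType) (n : nat) (H : 'M[R]_n)
    (d : measure_display) (T : measurableType d) (P : probability T R)
    (X : nat * nat * option 'I_n -> T -> 'I_n) : Prop :=
  [/\ forall a u, measurable [set w | X a w = u],
      forall j t i u, P [set w | X (j, t, i) w = u] = (draw_law H i u)%:E
    & forall (s : seq (nat * nat * option 'I_n))
             (u : nat * nat * option 'I_n -> 'I_n), uniq s ->
        P [set w | forall a, a \in s -> X a w = u a] =
        (\prod_(a <- s) P [set w | X a w = u a])%E].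

(* Repetition [j], continued beyond the round where the algorithm stops it. *)
Definition run (n : nat) (T : Type) (m : update_mode) (s0 : config n)
    (X : nat * nat * option 'I_n -> T -> 'I_n) (j : nat) (w : T)
    (t : nat) : config n :=
  trajectory m s0 (fun t' i => X (j, t', i) w) t.

(* All repetitions have the same law, hence it suffices to refer to number 0
   in the next two definitions. *)
Definition always_converges (R : realType) (n : nat) (m : update_mode)
    (d : measure_display) (T : measurableType d) (P : probability T R)
    (X : nat * nat * option 'I_n -> T -> 'I_n) : Prop :=
  forall s : config n, (exists v, gnostic (s v)) ->
    P [set w | exists t, consensus red (run m s X 0 w t) \/
                         consensus blue (run m s X 0 w t)] = 1%E.

Definition red_consensus_probability (R : realType) (n : nat)
    (m : update_mode) (s0 : config n)
    (d : measure_display) (T : measurableType d) (P : probability T R)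
    (X : nat * nat * option 'I_n -> T -> 'I_n) : R :=
  fine (P [set w | exists t, consensus red (run m s0 X 0 w t)]).

(** ** The Monte Carlo algorithm *)

Definition stops_at (n : nat) (s : nat -> config n) (t : nat) : Prop :=
  all_gnostic (s t) /\ forall t', (t' < t)%N -> ~~ all_gnostic (s t').

(* Number of simulated rounds; 0 is a junk value when the run never stops. *)
Definition rounds (n : nat) (s : nat -> config n) : nat :=
  xget 0%N [set t | stops_at s t].

Definition output (R : realType) (n : nat) (mu : 'rV[R]_n)
    (s : nat -> config n) : R :=
  \sum_(v | s (rounds s) v == red) mu 0 v.

Definition estimate (R : realType) (n : nat) (mu : 'rV[R]_n) (k : nat)
    (r : nat -> nat -> config n) : R :=
  k%:R^-1 * \sum_(j < k) output mu (r j).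

(* Cost model: computing [mu] from [H] costs [n ^ 3]; a random draw of a node
   costs [n] (one scan of a probability vector), and a round needs [n] draws
   in synchronous mode and 2 in asynchronous mode; testing whether all nodes
   are gnostic, at the start and after each round, costs [n], and so does
   computing the output of a run. *)
Definition draws_per_round (m : update_mode) (n : nat) : nat :=
  if m is Synchronous then n else 2.

Definition run_cost (m : update_mode) (n : nat) (s : nat -> config n) : nat :=
  (rounds s * (draws_per_round m n * n) + (rounds s).+1 * n + n)%N.

Definition total_cost (m : update_mode) (n : nat) (k : nat)
    (r : nat -> nat -> config n) : nat :=
  (n ^ 3 + \sum_(j < k) run_cost m (r j))%N.

Definition repetitions (R : realType) (omega eps c : R) : nat :=
  `|Num.ceil (2 * omega / (eps ^+ 2 * c ^+ 2))|%N.

(* Value at [(x, y, z)] of a polynomial in three variables. *)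
Definition eval3 (R : realType) (Q : {poly {poly {poly R}}}) (x y z : R) : R :=
  Q.[x%:P%:P].[y%:P].[z].

(* Main.v *)
(** Let [M t] be the stationary mass of the red nodes at round [t].  A pull
    leaves a colour in place only when the selected neighbour is agnostic, so
    [M] is a submartingale, and a martingale once all nodes are gnostic.  It
    lies in [0, 1] and converges to the indicator of red consensus; hence
    [c >= M 0 > 0], and optional stopping shows that the output of one run has
    mean [c].  While some node is agnostic, a round makes a new node gnostic
    with probability at least [p] (synchronous) or [p / n] (asynchronous), so a
    run stops after at most [n ^ 2 / p] rounds on average.  Chebyshev's
    inequality for the estimate and Markov's inequality for the total number of
    rounds conclude.

    The probabilistic estimates are finite sums over the draws of all the runs
    up to a common horizon.  As the horizon grows, these cylinder events
    exhaust the success event, and the error made on [c] tends to 0. *)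
Require Import Defs.
From mathcomp Require Import all_boot all_order all_algebra.
From mathcomp Require Import all_classical all_reals all_analysis.
From mathcomp Require Import ring lra.

Set Implicit Arguments.
Unset Strict Implicit.
Unset Printing Implicit Defensive.
Import Order.TTheory GRing.Theory Num.Theory numFieldNormedType.Exports.
Local Open Scope classical_set_scope.
Local Open Scope ring_scope.

(** * Expectation over a finite product *)

Section ProductExpectation.
Variables (R : realFieldType) (I A : finType) (p : I -> A -> R).

Definition weight (x : {ffun I -> A}) : R := \prod_i p i (x i).
Definition Ex (F : {ffun I -> A} -> R) : R := \sum_x weight x * F x.

Lemma eq_Ex (F G : {ffun I -> A} -> R) : F =1 G -> Ex F = Ex G.
Proof. by move=> FG; apply: eq_bigr => x _; rewrite FG. Qed.

Lemma ExD (F G : {ffun I -> A} -> R) : Ex (fun x => F x + G x) = Ex F + Ex G.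
Proof. by rewrite -big_split; apply: eq_bigr => x _; rewrite mulrDr. Qed.

Lemma ExZ (a : R) (F : {ffun I -> A} -> R) : Ex (fun x => a * F x) = a * Ex F.
Proof. by rewrite mulr_sumr; apply: eq_bigr => x _; rewrite mulrCA. Qed.

Lemma ExB (F G : {ffun I -> A} -> R) : Ex (fun x => F x - G x) = Ex F - Ex G.
Proof.
rewrite ExD -[- Ex G]mulN1r -ExZ; congr (_ + _).
by apply: eq_Ex => x; rewrite mulN1r.
Qed.

Lemma Ex_sum (J : Type) (s : seq J) (F : J -> {ffun I -> A} -> R) :
  Ex (fun x => \sum_(j <- s) F j x) = \sum_(j <- s) Ex (F j).
Proof.
by rewrite exchange_big; apply: eq_bigr => x _; rewrite mulr_sumr.
Qed.

Hypothesis p_ge0 : forall i a, 0 <= p i a.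
Hypothesis p_sum1 : forall i, \sum_a p i a = 1.

Lemma weight_ge0 (x : {ffun I -> A}) : 0 <= weight x.
Proof. by apply: prodr_ge0 => i _; apply: p_ge0. Qed.

Lemma weight_sum1 : \sum_x weight x = 1.
Proof. by rewrite -bigA_distr_bigA big1. Qed.

Lemma Ex_cst (a : R) : Ex (fun=> a) = a.
Proof. by rewrite /Ex -mulr_suml weight_sum1 mul1r. Qed.

Lemma le_Ex (F G : {ffun I -> A} -> R) :
  (forall x, F x <= G x) -> Ex F <= Ex G.
Proof. by move=> FG; apply: ler_sum => x _; rewrite ler_wpM2l ?weight_ge0. Qed.

(* Two independent copies of [x] may exchange their coordinates outside [K]:
   this preserves the law of the pair and turns [F x * G y] into
   [F x * G x]. *)
Lemma Ex_indep (K : {pred I}) (F G : {ffun I -> A} -> R) :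
    (forall x y : {ffun I -> A}, {in K, x =1 y} -> F x = F y) ->
    (forall x y : {ffun I -> A}, {in [predC K], x =1 y} -> G x = G y) ->
  Ex (fun x => F x * G x) = Ex F * Ex G.
Proof.
move=> FK GK.
pose mix (x y : {ffun I -> A}) := [ffun i => if i \in K then x i else y i].
pose sw (z : {ffun I -> A} * {ffun I -> A}) := (mix z.1 z.2, mix z.2 z.1).
have sw_inj : injective sw.
  apply: (can_inj (g := sw)) => -[x y]; rewrite /sw /=.
  by congr pair; apply/ffunP => i; rewrite !ffunE; case: (i \in K).
have -> : Ex (fun x => F x * G x) =
    \sum_z weight z.1 * weight z.2 * (F z.1 * G z.1).
  rewrite -(pair_bigA _ (fun x y => weight x * weight y * (F x * G x))) /=.
  apply: eq_bigr => x _; rewrite -mulr_suml -mulr_sumr.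
  by rewrite weight_sum1 mulr1.
rewrite (reindex_inj sw_inj) /= /Ex mulr_suml.
under [RHS]eq_bigr do rewrite mulr_sumr.
rewrite pair_bigA; apply: eq_bigr => -[x y] _ /=.
have -> : F (mix x y) = F x by apply: FK => i iK; rewrite ffunE iK.
have -> : G (mix x y) = G y.
  by apply: GK => i iK; rewrite ffunE; move: iK; rewrite inE => /negbTE ->.
have -> : weight (mix x y) * weight (mix y x) = weight x * weight y.
  rewrite /weight -!big_split; apply: eq_bigr => i _ /=; rewrite !ffunE.
  by case: ifP => // _; rewrite mulrC.
by rewrite mulrACA.
Qed.

(** Absorbing [f] into the factor of coordinate [i] turns the expectation into a product of one sum
    per coordinate, and all the other sums are 1. *)
Lemma Ex_coord (i : I) (f : A -> R) :
  Ex (fun x => f (x i)) = \sum_a p i a * f a.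
Proof.
pose g j a := if j == i then p j a * f a else p j a.
transitivity (\prod_j \sum_a g j a).
  rewrite bigA_distr_bigA; apply: eq_bigr => x _.
  rewrite /weight (bigD1 i) //= [RHS](bigD1 i) //= /g eqxx mulrAC.
  by congr (_ * _); apply: eq_bigr => j /negbTE ->.
rewrite (bigD1 i) //= [X in _ * X]big1 ?mulr1.
  by apply: eq_bigr => a _; rewrite /g eqxx.
by move=> j /negbTE ji; under eq_bigr do rewrite /g ji.
Qed.

Lemma Ex_coord2 (i j : I) (f g : A -> R) : i != j ->
  Ex (fun x => f (x i) * g (x j)) =
  (\sum_a p i a * f a) * (\sum_a p j a * g a).
Proof.
move=> ij; rewrite (@Ex_indep (pred1 i)) ?Ex_coord//.
- by move=> x y xy; rewrite xy ?inE.
- by move=> x y xy; rewrite xy ?inE // eq_sym.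
Qed.

Lemma Ex_markov (F : {ffun I -> A} -> R) (a : R) :
    (forall x, 0 <= F x) -> 0 < a ->
  Ex (fun x => (a < F x)%R%:R) <= Ex F / a.
Proof.
move=> F0 a0; rewrite mulrC -ExZ; apply: le_Ex => x.
have [aF|_] := ltP a (F x).
  by rewrite mulr1n mulrC ler_pdivlMr // mul1r ltW.
by rewrite mulr0n mulr_ge0 // invr_ge0 ltW.
Qed.

End ProductExpectation.

(** * One round *)

(** Strong connectivity enters only through this lemma: it yields an edge from an agnostic to a
    gnostic node, and spreads the positivity of [mu]. *)
Lemma connect_exit (T : finType) (e : rel T) (P : pred T) (v u : T) :
  connect e v u -> P v -> ~~ P u -> exists x y, [/\ e x y, P x & ~~ P y].
Proof.
case/connectP => s; elim: s v => [|w s IH] v /=.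
  by move=> _ -> ->.
case/andP => evw ws us Pv; have [Pw|Pw _] := boolP (P w); first exact: (IH w).
by exists v, w.
Qed.

Definition mass (R : realType) (n : nat) (mu : 'rV[R]_n) (s : config n) : R :=
  \sum_(v | s v == red) mu 0 v.

(** Probability that a given node updates in one round. *)
Definition update_rate (R : realType) (m : update_mode) (n : nat) : R :=
  if m is Synchronous then 1 else n%:R^-1.

Section OneRound.
Variables (R : realType) (n : nat) (E : rel 'I_n) (H : 'M[R]_n).
Hypotheses (n_gt0 : (0 < n)%N) (HE : transition_matrix E H).

Lemma transition_ge0 v u : 0 <= H v u.
Proof.
case: HE => /(_ v u) [pos nul] _.
by case: (boolP (E v u)) => [/pos/ltW//|/nul->].
Qed.

Lemma draw_law_ge0 i u : 0 <= draw_law H i u.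
Proof. by case: i => [v|] /=; rewrite ?transition_ge0 // invr_ge0. Qed.

Lemma draw_law_sum1 i : \sum_u draw_law H i u = 1.
Proof.
case: i => [v|] /=; first by case: HE.
rewrite sumr_const card_ord -[RHS](@mulVf _ n%:R) ?mulr_natr //.
by rewrite pnatr_eq0 -lt0n.
Qed.

Lemma update_rate_gt0 m : 0 < update_rate R m n.
Proof. by case: m => //=; rewrite invr_gt0 ltr0n. Qed.

Lemma Ex_step m (s : config n) v (psi : node_state -> R) :
  Ex (draw_law H) (fun a => psi (step m s a v)) =
  psi (s v) + update_rate R m n *
              \sum_u H v u * (psi (pull s v u) - psi (s v)).
Proof.
have lge0 := draw_law_ge0; have lsum1 := draw_law_sum1; case: m => /=.
  under eq_Ex do rewrite ffunE.
  rewrite (Ex_coord lsum1 (Some v) (fun u => psi (pull s v u))) /=.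
  rewrite mul1r; under [X in _ + X]eq_bigr do rewrite mulrBr.
  rewrite sumrB -mulr_suml; case: HE => _ ->.
  by rewrite mul1r addrC subrK.
pose f (u : 'I_n) : R := (v == u)%:R.
pose g u : R := psi (pull s v u) - psi (s v).
(* The change at [v] is the activation indicator times the effect of the pull. They depend on the
   distinct coordinates [None] and [Some v], hence are independent. *)
transitivity (Ex (draw_law H) (fun a => psi (s v) + f (a None) * g (a (Some v)))).
  apply: eq_Ex => a; rewrite ffunE /f /g; case: eqP => _.
    by rewrite mul1r addrC subrK.
  by rewrite mul0r addr0.
rewrite ExD Ex_cst // Ex_coord2 //=; congr (_ + _ * _).
rewrite (bigD1 v) //= big1 ?addr0 /f ?eqxx ?mulr1 //.
by move=> u; rewrite eq_sym => /negbTE ->; rewrite mulr0.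
Qed.

Lemma mass_ge0 (mu : 'rV[R]_n) s :
  (forall v, 0 <= mu 0 v) -> 0 <= mass mu s.
Proof. by move=> mu0; apply: sumr_ge0. Qed.

Lemma massE (mu : 'rV[R]_n) s : mass mu s = \sum_v mu 0 v * (s v == red)%:R.
Proof.
by rewrite /mass big_mkcond; apply: eq_bigr => v _; case: eqP; rewrite ?mulr1 ?mulr0.
Qed.

Lemma mass_le1 (mu : 'rV[R]_n) s :
  (forall v, 0 <= mu 0 v) -> \sum_v mu 0 v = 1 -> mass mu s <= 1.
Proof.
by move=> mu0 <-; rewrite massE; apply: ler_sum => v _; case: eqP; rewrite ?mulr1 ?mulr0.
Qed.

Lemma Ex_mass_step (mu : 'rV[R]_n) m (s : config n) :
  Ex (draw_law H) (fun a => mass mu (step m s a)) = mass mu s +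
  update_rate R m n *
    \sum_v mu 0 v * \sum_u H v u * ((pull s v u == red)%:R - (s v == red)%:R).
Proof.
under eq_Ex do rewrite massE.
rewrite Ex_sum massE mulr_sumr -big_split; apply: eq_bigr => v _ /=.
rewrite ExZ (Ex_step m s v (fun x => (x == red)%:R)).
by rewrite mulrDr mulrCA.
Qed.

(* Stationarity makes the mean drift vanish when every pull copies a colour. *)
Lemma stationary_drift (mu : 'rV[R]_n) (s : config n) : mu *m H = mu ->
  \sum_v mu 0 v * \sum_u H v u * ((s u == red)%:R - (s v == red)%:R) = 0.
Proof.
move=> muH.
have -> : \sum_v mu 0 v * \sum_u H v u * ((s u == red)%:R - (s v == red)%:R) =
          mass (mu *m H) s - mass mu s.
  rewrite !massE; under [X in _ = X - _]eq_bigr do rewrite mxE mulr_suml.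
  rewrite exchange_big -sumrB; apply: eq_bigr => v _ /=.
  under eq_bigr do rewrite mulrBr.
  rewrite sumrB -mulr_suml; case: HE => _ ->.
  rewrite mul1r mulrBr mulr_sumr.
  by congr (_ - _); apply: eq_bigr => u _; rewrite mulrA.
by rewrite muH subrr.
Qed.

Lemma mass_submartingale (mu : 'rV[R]_n) m (s : config n) :
  (forall v, 0 <= mu 0 v) -> mu *m H = mu ->
  mass mu s <= Ex (draw_law H) (fun a => mass mu (step m s a)).
Proof.
move=> mu0 muH; rewrite Ex_mass_step lerDl.
apply: mulr_ge0; first exact/ltW/update_rate_gt0.
(* Compare with the vanishing drift in which [v] always takes the state of [u]: the pull differs
   only when [u] is agnostic, thus not red, and can then only add red. *)
rewrite -[leLHS](stationary_drift s muH); apply: ler_sum => v _.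
apply: ler_wpM2l => //; apply: ler_sum => u _.
apply: ler_wpM2l; rewrite ?transition_ge0 // lerD2r /pull.
by case: ifP => //; case: (s u).
Qed.

Lemma mass_martingale (mu : 'rV[R]_n) m (s : config n) :
  mu *m H = mu -> all_gnostic s ->
  Ex (draw_law H) (fun a => mass mu (step m s a)) = mass mu s.
Proof.
move=> muH /forallP gs; rewrite Ex_mass_step.
under eq_bigr => v _ do under eq_bigr => u _ do rewrite /pull gs.
by rewrite stationary_drift // mulr0 addr0.
Qed.

Definition gnostic_count (s : config n) : R := \sum_v (gnostic (s v))%:R.

Lemma gnostic_count_ge0 s : 0 <= gnostic_count s.
Proof. by apply: sumr_ge0. Qed.

Lemma gnostic_count_le s : gnostic_count s <= n%:R.
Proof.
rewrite -[n in X in _ <= X]card_ord -sum1_card natr_sum.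
by apply: ler_sum => v _; case: gnostic.
Qed.

(* Some agnostic node has a gnostic out-neighbour, and copies it with
   probability at least [update_rate * p]. *)
Lemma gnostic_count_step m (s : config n) (p : R) :
  strongly_connected E -> smallest_nonzero_entry H p ->
  (exists v, gnostic (s v)) -> ~~ all_gnostic s ->
  gnostic_count s + update_rate R m n * p <=
  Ex (draw_law H) (fun a => gnostic_count (step m s a)).
Proof.
move=> sc [_ _ pmin] [u gu] /forallPn[v nv].
have [x [y [Exy nx gy]]] := @connect_exit _ E (fun x => ~~ gnostic (s x)) v u (sc v u)
  nv (introT negPn gu).
have le_pull w z : (gnostic (s w))%:R <= (gnostic (pull s w z))%:R :> R.
  by rewrite /pull; case: ifP => [->|//]; rewrite ler_nat leq_b1.
rewrite /gnostic_count Ex_sum.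
under [leRHS]eq_bigr do rewrite (Ex_step m s _ (fun z => (gnostic z)%:R)).
rewrite big_split lerD2l -mulr_sumr ler_wpM2l ?(ltW (update_rate_gt0 m)) //.
rewrite (bigD1 x) //= (bigD1 y) //= -addrA.
have -> : pull s x y = s y by rewrite /pull (negPn gy).
rewrite (negPn gy) (negbTE nx) subr0 mulr1.
have [/(_ Exy) Hpos _] := HE.1 x y.
rewrite -[p]addr0 lerD ?pmin ?gt_eqF // addr_ge0 // ?sumr_ge0 // => w _.
  by rewrite mulr_ge0 ?transition_ge0 // subr_ge0; have := le_pull x w; rewrite (negbTE nx).
by apply: sumr_ge0 => z _; rewrite mulr_ge0 ?transition_ge0 // subr_ge0.
Qed.

(** Total mass 1 makes some node positive, and [mu *m H = mu] passes positivity along every edge. *)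
Lemma stationary_gt0 (mu : 'rV[R]_n) : strongly_connected E ->
  stationary_distribution H mu -> forall v, 0 < mu 0 v.
Proof.
move=> sc [mu0 mu1 muH].
have pos_edge x y : E x y -> 0 < mu 0 x -> 0 < mu 0 y.
  move=> Exy mux; rewrite -muH mxE (bigD1 x) //= ltr_pwDl //.
    by rewrite mulr_gt0 //; case: (HE.1 x y) => ->.
  by apply: sumr_ge0 => z _; rewrite mulr_ge0 ?transition_ge0.
have [x mux] : exists x, 0 < mu 0 x.
  apply: contrapT => /forallNP none; have := oner_neq0 R; rewrite -mu1 big1 ?eqxx//.
  by move=> x _; have [//|mux] := eqVneq (mu 0 x) 0; case: (none x); rewrite lt_def mux mu0.
move=> v; have [//|muv] := boolP (0 < mu 0 v).
by have [y [z [Eyz /(pos_edge _ _ Eyz) -> //]]] :=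
  @connect_exit _ E (fun x => 0 < mu 0 x) x v (sc x v) mux muv.
Qed.

End OneRound.

(** * A run up to a horizon *)

Lemma gnostic_pull n (s : config n) v u :
  gnostic (s v) -> gnostic (pull s v u).
Proof. by rewrite /pull; case: ifP. Qed.

Lemma gnostic_step n m (s : config n) x v :
  gnostic (s v) -> gnostic (step m s x v).
Proof.
by case: m => /= gv; rewrite ffunE ?gnostic_pull //; case: ifP => _; rewrite ?gnostic_pull.
Qed.

Lemma all_gnostic_step n m (s : config n) x :
  all_gnostic s -> all_gnostic (step m s x).
Proof. by move/forallP => gs; apply/forallP => v; apply: gnostic_step. Qed.

Lemma consensus_step n m c (s : config n) x :
  consensus (Some c) s -> consensus (Some c) (step m s x).
Proof.
move=> /forallP cs; have pullc v u : pull s v u = Some c.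
  by rewrite /pull (eqP (cs u)) (eqP (cs v)).
apply/forallP => v; case: m => /=; rewrite ffunE ?pullc //.
by case: ifP; rewrite ?pullc.
Qed.

Lemma consensus_all_gnostic n c (s : config n) :
  consensus (Some c) s -> all_gnostic s.
Proof. by move=> /forallP cs; apply/forallP => v; rewrite (eqP (cs v)). Qed.

Lemma all_gnostic_trajectory n m (s0 : config n) x t t' : (t <= t')%N ->
  all_gnostic (trajectory m s0 x t) -> all_gnostic (trajectory m s0 x t').
Proof.
move=> /subnKC <-; elim: (t' - t)%N => [|k IH]; rewrite ?addn0 // addnS.
by move=> /IH; apply: all_gnostic_step.
Qed.

Lemma gnostic_trajectory n m (s0 : config n) x t :
  (exists v, gnostic (s0 v)) -> exists v, gnostic (trajectory m s0 x t v).
Proof.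
move=> [v gv]; exists v.
by elim: t => [//|t IH]; apply: gnostic_step.
Qed.

Lemma eq_trajectory n m (s0 : config n) x y t :
  (forall t', (t' < t)%N -> x t' =1 y t') ->
  trajectory m s0 x t = trajectory m s0 y t.
Proof.
elim: t => [//|t IH] xy /=.
rewrite IH => [|t' lt_t't]; last by apply: xy; apply: ltnW.
have := xy t (ltnSn t); case: m {IH} xy => _ /= xy; apply/ffunP => v; rewrite !ffunE ?xy //.
Qed.

(* For an absorbing run this is [min t tau], where [tau] is the first round
   at which all nodes are gnostic. *)
Definition unstopped_rounds n (s : nat -> config n) (t : nat) : nat :=
  \sum_(t' < t) ~~ all_gnostic (s t').

Lemma unstopped_roundsS n (s : nat -> config n) t :
  unstopped_rounds s t.+1 = (unstopped_rounds s t + ~~ all_gnostic (s t))%N.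
Proof. exact: big_ord_recr. Qed.

Lemma stops_at_inj n (s : nat -> config n) t t' :
  stops_at s t -> stops_at s t' -> t = t'.
Proof.
move=> [gt nt] [gt' nt'].
by case: (ltngtP t t') => [/nt'|/nt|//]; rewrite ?gt ?gt'.
Qed.

Lemma rounds_stops_at n (s : nat -> config n) t : stops_at s t -> rounds s = t.
Proof. by move=> st; apply: xget_unique => // t' /stops_at_inj; apply. Qed.

Lemma exists_stops_at n (s : nat -> config n) t :
  all_gnostic (s t) -> exists2 tau, (tau <= t)%N & stops_at s tau.
Proof.
move=> gt; have ex : exists t, all_gnostic (s t) by exists t.
case: (ex_minnP ex) => tau gtau mintau; exists tau; first exact: mintau.
by split=> // t' lt_t'; apply: contraL lt_t' => /mintau; rewrite -leqNgt.
Qed.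

Section Absorbing.
Variables (n : nat) (s : nat -> config n).
Hypothesis absorbing :
  forall t t', (t <= t')%N -> all_gnostic (s t) -> all_gnostic (s t').

Lemma unstopped_rounds_running t :
  ~~ all_gnostic (s t) -> unstopped_rounds s t = t.
Proof.
elim: t => [|t IH] nt; first by rewrite /unstopped_rounds big_ord0.
have nt' : ~~ all_gnostic (s t) by apply: contra nt; apply: absorbing.
by rewrite unstopped_roundsS IH // nt' addn1.
Qed.

Lemma unstopped_rounds_stops_at t tau : (tau <= t)%N ->
  stops_at s tau -> unstopped_rounds s t = tau.
Proof.
move=> /subnKC <- [gt nt]; elim: (t - tau)%N => [|k IH].
  rewrite addn0 /unstopped_rounds; under eq_bigr => t' _ do rewrite nt //.
  by rewrite sum_nat_const card_ord muln1.
by rewrite addnS unstopped_roundsS IH (absorbing _ gt) ?leq_addr ?addn0.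
Qed.

Lemma stops_at_unstopped_rounds t :
  all_gnostic (s t) -> stops_at s (unstopped_rounds s t).
Proof.
by move=> /exists_stops_at[tau le_tau stau]; rewrite (unstopped_rounds_stops_at le_tau).
Qed.

(** Before stopping, [unstopped_rounds] equals the current round; afterwards it no longer grows, so
    the stopped process is frozen. *)
Lemma stopped_increment (R : zmodType) (f : config n -> R) t :
  f (s (unstopped_rounds s t.+1)) - f (s (unstopped_rounds s t)) =
  (f (s t.+1) - f (s t)) *+ ~~ all_gnostic (s t).
Proof.
rewrite unstopped_roundsS; case: (boolP (all_gnostic (s t))) => [_|nt].
  by rewrite addn0 subrr mulr0n.
by rewrite (unstopped_rounds_running nt) addn1 mulr1n.
Qed.

End Absorbing.

Section Run.
Variables (R : realType) (n : nat) (E : rel 'I_n) (H : 'M[R]_n).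
Hypotheses (n_gt0 : (0 < n)%N) (HE : transition_matrix E H).
Variables (N : nat) (m : update_mode) (s0 : config n).

Definition round_draws : finType := {ffun option 'I_n -> 'I_n}.
Definition run_draws : finType := {ffun 'I_N.+1 -> round_draws}.

(** [inord t'] is faithful only for [t' <= N] and falls back to round 0 beyond, so the horizon is
    round [N.+1]. *)
Definition traj (x : run_draws) (t : nat) : config n :=
  trajectory m s0 (fun t' => x (inord t')) t.

Definition round_weight (i : 'I_N.+1) (a : round_draws) : R :=
  weight (draw_law H) a.

Local Notation run_Ex := (Ex round_weight).

Lemma round_weight_ge0 i a : 0 <= round_weight i a.
Proof. exact/weight_ge0/(draw_law_ge0 HE). Qed.

Lemma round_weight_sum1 i : \sum_a round_weight i a = 1.
Proof. exact/weight_sum1/(draw_law_sum1 n_gt0 HE). Qed.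

(** Markov property: the state at round [t] depends only on earlier draws, so the draws of round [t]
    can be averaged out with the state held fixed. *)
Lemma traj_markov t (F : config n -> round_draws -> R) : (t <= N)%N ->
  run_Ex (fun x => F (traj x t) (x (inord t))) =
  run_Ex (fun x => Ex (draw_law H) (F (traj x t))).
Proof.
(* Splitting over the value of the state gives products of an indicator of the past with a function
   of the round, to which [Ex_indep] applies. *)
move=> tN; have split_state (G : config n -> R) s :
    G s = \sum_s' (s == s')%:R * G s'.
  rewrite (bigD1 s) //= eqxx mul1r big1 ?addr0 // => s' /negbTE.
  by rewrite eq_sym => ->; rewrite mul0r.
transitivity (run_Ex (fun x => \sum_s (traj x t == s)%:R * F s (x (inord t)))).
  by apply: eq_Ex => x; exact: (split_state (F^~ (x (inord t)))).
transitivity (run_Ex (fun x => \sum_s (traj x t == s)%:R * Ex (draw_law H) (F s))); last first.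
  by apply: eq_Ex => x; rewrite [RHS](split_state (fun s => Ex (draw_law H) (F s))).
rewrite !Ex_sum; apply: eq_bigr => s _.
rewrite (@Ex_indep _ _ _ _ round_weight_sum1 [pred i : 'I__ | (i < t)%N]
          (fun x => (traj x t == s)%:R) (fun x => F s (x (inord t)))).
- rewrite (Ex_coord round_weight_sum1 (inord t) (F s)) mulrC -ExZ.
  by apply: eq_Ex => x; rewrite mulrC.
- move=> x y xy; congr ((_ == s)%:R); apply: eq_trajectory => t' t't i.
  by rewrite xy // inE inordK // ltnS (leq_trans (ltnW t't)).
- by move=> x y xy; rewrite xy // !inE inordK ?ltnS // ltnn.
Qed.

Lemma absorbing_traj (x : run_draws) t t' : (t <= t')%N ->
  all_gnostic (traj x t) -> all_gnostic (traj x t').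
Proof. exact: all_gnostic_trajectory. Qed.

Section Mass.
Variable mu : 'rV[R]_n.
Hypothesis mu_stat : stationary_distribution H mu.

Lemma mean_mass_ge t : (t <= N.+1)%N ->
  mass mu s0 <= run_Ex (fun x => mass mu (traj x t)).
Proof.
elim: t => [_|t IH tN].
  by rewrite /traj /= (Ex_cst round_weight_sum1).
apply: (le_trans (IH (ltnW tN))) => /=; rewrite /traj /= -/(traj _ _).
rewrite (@traj_markov t (fun s a => mass mu (step m s a))) //.
by apply: (le_Ex round_weight_ge0) => x; case: mu_stat => *; apply: (mass_submartingale n_gt0 HE).
Qed.

(* Optional stopping: the mass only drifts before all nodes are gnostic. *)
Lemma mean_stopped_mass t : (t <= N.+1)%N ->
  run_Ex (fun x => mass mu (traj x (unstopped_rounds (traj x) t))) =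
  run_Ex (fun x => mass mu (traj x t)).
Proof.
elim: t => [_|t IH tN].
  by apply: eq_Ex => x; rewrite /unstopped_rounds big_ord0.
(* The stopped and unstopped increments agree before stopping. Afterwards they differ by [inc],
   which has mean 0 by the martingale property. *)
pose inc (s : config n) (a : round_draws) :=
  (all_gnostic s)%:R * (mass mu (step m s a) - mass mu s).
have : run_Ex (fun x =>
    (mass mu (traj x (unstopped_rounds (traj x) t.+1)) -
     mass mu (traj x (unstopped_rounds (traj x) t))) -
    (mass mu (traj x t.+1) - mass mu (traj x t))) = 0.
  transitivity (run_Ex (fun x => -1 * inc (traj x t) (x (inord t)))).
    apply: eq_Ex => x; rewrite (stopped_increment (absorbing_traj (x := x))) /inc.
    rewrite -[step _ _ _]/(traj x t.+1).
    by case: (all_gnostic _) => /=; rewrite ?mulr0n ?mulr1n; ring.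
  rewrite ExZ traj_markov //.
  under eq_Ex do rewrite /inc.
  under eq_Ex => x.
    rewrite ExZ ExB (Ex_cst (draw_law_sum1 n_gt0 HE)); over.
  rewrite (eq_Ex _ (G := fun=> 0)) ?(Ex_cst round_weight_sum1) ?mulr0 // => x.
  case: (boolP (all_gnostic _)) => g; rewrite ?mul0r //.
  by case: mu_stat => _ _ ?; rewrite (mass_martingale n_gt0 HE) // subrr mulr0.
by rewrite !ExB IH ?(ltnW tN) // => ?; lra.
Qed.

End Mass.

(** Potential argument: each unstopped round raises the mean of [gnostic_count] by at least
    [update_rate * p], and this count never exceeds [n]. *)
Lemma mean_unstopped_rounds (p : R) t :
  strongly_connected E -> smallest_nonzero_entry H p ->
  (exists v, gnostic (s0 v)) -> (t <= N.+1)%N ->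
  update_rate R m n * p * run_Ex (fun x => (unstopped_rounds (traj x) t)%:R)
  <= n%:R.
Proof.
move=> sc smallest s0g tN.
suff /le_trans : update_rate R m n * p *
    run_Ex (fun x => (unstopped_rounds (traj x) t)%:R) <=
    run_Ex (fun x => gnostic_count R (traj x t)).
  apply; rewrite -[leRHS](Ex_cst round_weight_sum1).
  by apply: (le_Ex round_weight_ge0) => x; apply: gnostic_count_le.
elim: t tN => [_|t IH tN].
  rewrite (eq_Ex _ (G := fun=> 0)) => [|x]; last by rewrite /unstopped_rounds big_ord0.
  rewrite (Ex_cst round_weight_sum1) mulr0 -[leLHS](Ex_cst round_weight_sum1).
  by apply: (le_Ex round_weight_ge0) => x; apply: gnostic_count_ge0.
under eq_Ex do rewrite unstopped_roundsS natrD.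
rewrite ExD mulrDr (le_trans (lerD (IH (ltnW tN)) (lexx _))) //.
rewrite -ExZ -ExD [leRHS](@traj_markov t (fun s a => gnostic_count R (step m s a))) //.
apply: (le_Ex round_weight_ge0) => x; case: (boolP (all_gnostic _)) => g /=.
  rewrite mulr0 addr0 -[leLHS](Ex_cst (draw_law_sum1 n_gt0 HE)).
  apply: (le_Ex (draw_law_ge0 HE)) => a; apply: ler_sum => v _.
  by rewrite ler_nat; case: (boolP (gnostic _)) => // /gnostic_step ->.
rewrite mulr1; apply: (gnostic_count_step n_gt0 HE) => //.
exact: gnostic_trajectory.
Qed.
End Run.

(** * Finitely many draws as cylinder events *)

Section Observation.
Variables (R : realType) (n : nat) (E : rel 'I_n) (H : 'M[R]_n).
Hypotheses (n_gt0 : (0 < n)%N) (HE : transition_matrix E H).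
Variables (d : measure_display) (T : measurableType d) (P : probability T R).
Variable X : nat * nat * option 'I_n -> T -> 'I_n.
Hypothesis XP : independent_draws H P X.

Definition runs_draws (k N : nat) : finType := {ffun 'I_k -> run_draws n N}.

Definition run_weight (N : nat) (x : run_draws n N) : R :=
  weight (round_weight H (N := N)) x.

Lemma run_weight_ge0 N (x : run_draws n N) : 0 <= run_weight x.
Proof. exact/weight_ge0/(round_weight_ge0 HE). Qed.

Lemma run_weight_sum1 N : \sum_(x : run_draws n N) run_weight x = 1.
Proof. exact/weight_sum1/(round_weight_sum1 n_gt0 HE). Qed.

Definition observed (k N : nat) (w : T) : runs_draws k N :=
  [ffun j : 'I_k => [ffun t : 'I_N.+1 => [ffun i => X (val j, val t, i) w]]].

Lemma observed_run k N m s0 (j : 'I_k) w t : (t <= N.+1)%N ->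
  traj m s0 (observed k N w j) t = run m s0 X j w t.
Proof.
move=> tN; apply: eq_trajectory => t' t't i.
by rewrite !ffunE /= inordK // (leq_trans t't).
Qed.

Lemma observed_eq k N (x : runs_draws k N) :
  measurable [set w | observed k N w = x] /\
  P [set w | observed k N w = x] = (\prod_j run_weight (x j))%:E.
Proof.
case: XP => Xmeas Xlaw Xind.
pose idx (a : 'I_k * 'I_N.+1 * option 'I_n) := (val a.1.1, val a.1.2, a.2).
have idx_inj : injective idx.
  by move=> [[j t] i] [[j' t'] i'] [/val_inj-> /val_inj-> ->].
(* [independent_draws] takes an assignment on all triples, so [x] is extended; its values outside
   the observed box are arbitrary. *)
pose u (a : nat * nat * option 'I_n) : 'I_n :=
  if insub a.1.1 is Some j then x j (inord a.1.2) a.2 else Ordinal n_gt0.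
have uE j t i : u (val j, val t, i) = x j t i by rewrite /u /= valK inord_val.
have setE : [set w | observed k N w = x] =
    [set w | forall a, a \in map idx (enum predT) -> X a w = u a].
  apply/seteqP; split=> w /=.
    move=> wx a /mapP[[[j t] i] _ ->].
    by rewrite /idx /= uE -wx !ffunE.
  move=> wu; apply/ffunP => j; apply/ffunP => t; apply/ffunP => i.
  by rewrite !ffunE wu ?uE //; apply/mapP; exists (j, t, i); rewrite ?mem_enum.
split.
  have -> : [set w | observed k N w = x] = \bigcap_(a in [set: 'I_k * 'I_N.+1 * option 'I_n])
      [set w | X (idx a) w = u (idx a)].
    rewrite setE; apply/seteqP; split=> w /= wu.
      by move=> a _; apply: wu; rewrite map_f ?mem_enum.
    by move=> a /mapP[b _ ->]; apply: wu.
  by apply: fin_bigcap_measurable => // a _; apply: Xmeas.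
rewrite setE Xind; last by rewrite map_inj_uniq ?enum_uniq.
rewrite big_map big_enum /=.
under eq_bigr => a _ do rewrite /idx Xlaw uE.
rewrite prodEFin; congr EFin.
rewrite -(pair_bigA _ (fun a i => draw_law H i (x a.1 a.2 i))) /=.
rewrite -(pair_bigA _ (fun j t => \prod_i draw_law H i (x j t i))) /=.
by [].
Qed.

(** The event is a finite disjoint union of the atoms measured in [observed_eq]; this carries finite
    sums over to [P]. *)
Lemma observed_event k N (Phi : pred (runs_draws k N)) :
  measurable [set w | Phi (observed k N w)] /\
  P [set w | Phi (observed k N w)] =
  (Ex (fun _ : 'I_k => @run_weight N) (fun x => (Phi x)%:R))%:E.
Proof.
have -> : [set w | Phi (observed k N w)] =
    \bigcup_(x in [set` Phi]) [set w | observed k N w = x].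
  apply/seteqP; split=> w /=; first by move=> ?; exists (observed k N w).
  by case=> x Phix ->.
have fin : finite_set [set` Phi] by exact: finite_finset.
have meas x : [set` Phi] x -> measurable [set w | observed k N w = x].
  by move=> _; have [] := observed_eq x.
split; first exact: fin_bigcup_measurable.
rewrite measure_fin_bigcup //; last by move=> x y _ _ [w [/= <- <-]].
rewrite -(bigfs _ (index_enum_uniq (runs_draws k N))) => [|x _]; last first.
  by rewrite mem_index_enum.
transitivity (\sum_(x | Phi x) (\prod_j run_weight (x j))%:E)%E.
  by apply: eq_bigr => x _; apply: (observed_eq x).2.
rewrite sumEFin; congr EFin.
rewrite big_mkcond; apply: eq_bigr => x _ /=.
by case: (Phi x); rewrite ?mulr1 ?mulr0.
Qed.

(** Since [Phi] persists, its events at rounds [N.+1] increase to the event that it ever holds, and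
    continuity from below applies. Observing one repetition suffices. *)
Lemma absorbing_event_cvg m s0 (Phi : pred (config n)) :
    (forall x t, Phi (trajectory m s0 x t) -> Phi (trajectory m s0 x t.+1)) ->
  (fun N => Ex (round_weight H (N := N)) (fun x => (Phi (traj m s0 x N.+1))%:R))
    @ \oo --> fine (P [set w | exists t, Phi (run m s0 X 0 w t)]).
Proof.
move=> absPhi.
have absPhi_le w t t' : (t <= t')%N ->
    Phi (run m s0 X 0 w t) -> Phi (run m s0 X 0 w t').
  move=> /subnKC <-; elim: (t' - t)%N => [|i IH]; rewrite ?addn0 // addnS.
  by move=> /IH; apply: absPhi.
pose F N := [set w | Phi (run m s0 X 0 w N.+1)].
have FE N : F N = [set w | Phi (traj m s0 (observed 1 N w ord0) N.+1)].
  by rewrite /F; apply/funext => w /=; rewrite observed_run.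
have Fev N := observed_event (fun x : runs_draws 1 N => Phi (traj m s0 (x ord0) N.+1)).
have -> : [set w | exists t, Phi (run m s0 X 0 w t)] = \bigcup_N F N.
  apply/seteqP; split=> w /=; last by case=> N _ ?; exists N.+1.
  by case=> t Phit; exists t => //=; apply: (absPhi_le _ _ _ _ Phit).
have Fmeas N : measurable (F N) by rewrite FE; have [] := Fev N.
have -> : (fun N => Ex (round_weight H (N := N))
    (fun x => (Phi (traj m s0 x N.+1))%:R)) = fine \o (P \o F).
  apply/funext => N /=; rewrite FE (Fev N).2 /=.
  by rewrite (Ex_coord (fun _ => run_weight_sum1 N) ord0
    (fun x => (Phi (traj m s0 x N.+1))%:R)).
apply: fine_cvg; rewrite fineK.
  apply: nondecreasing_cvg_mu => //; first exact: bigcup_measurable.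
  by move=> N N' le_N; apply/subsetPset => w; apply: absPhi_le.
by apply: fin_num_measure; apply: bigcup_measurable.
Qed.

End Observation.

(** * Deviation and stopping estimates *)

(** Second moment bound around a centre [c] that need not be the mean of [f]: by independence each
    off-diagonal pair contributes the squared bias [D ^+ 2], and each diagonal one at most 1. The
    bias will come from truncating runs. *)
Lemma Ex_sample_mean (R : realFieldType) (A : finType) (q : A -> R) (k : nat)
    (f : A -> R) (c : R) :
  (forall a, 0 <= q a) -> \sum_a q a = 1 -> (0 < k)%N ->
  (forall a, 0 <= f a <= 1) -> 0 <= c <= 1 ->
  Ex (fun _ : 'I_k => q) (fun x => (k%:R^-1 * \sum_j f (x j) - c) ^+ 2) <=
  k%:R^-1 + (\sum_a q a * f a - c) ^+ 2.
Proof.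
move=> q0 q1 k0 f01 c01; pose g a := f a - c.
have q0' (j : 'I_k) := q0; have q1' (j : 'I_k) := q1.
have kn0 : k%:R != 0 :> R by rewrite pnatr_eq0 -lt0n.
set D := \sum_a q a * f a - c.
have DE : \sum_a q a * g a = D.
  by under eq_bigr do rewrite mulrBr; rewrite sumrB -mulr_suml q1 mul1r.
have sqE (x : {ffun 'I_k -> A}) : (k%:R^-1 * \sum_j f (x j) - c) ^+ 2 =
    k%:R^-1 ^+ 2 * \sum_j \sum_l g (x j) * g (x l).
  rewrite -big_distrlr /=.
  rewrite /g sumrB sumr_const card_ord -mulr_natl.
  by field.
under eq_Ex do rewrite sqE.
rewrite ExZ Ex_sum; under eq_bigr do rewrite Ex_sum.
have cov (j l : 'I_k) : Ex (fun _ : 'I_k => q) (fun x => g (x j) * g (x l)) <=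
    (j == l)%:R + D ^+ 2.
  have [->|jl] := eqVneq j l; last by rewrite Ex_coord2 // DE add0r expr2.
  rewrite (Ex_coord q1' l (fun a => g a * g a)) -[leLHS]addr0 lerD ?sqr_ge0 //.
  rewrite -[leRHS]q1; apply: ler_sum => a _; rewrite -[leRHS]mulr1.
  apply: ler_wpM2l => //; rewrite -expr2 -real_normK ?num_real // exprn_ile1 //.
  by rewrite ler_norml /g; have := f01 a; clear q0' q1'; lra.
apply: (@le_trans _ _ (k%:R^-1 ^+ 2 * \sum_(j < k) \sum_(l < k) ((j == l)%:R + D ^+ 2))).
  by rewrite ler_wpM2l ?sqr_ge0 //; apply: ler_sum => j _; apply: ler_sum.
have -> : \sum_(j < k) \sum_(l < k) ((j == l)%:R + D ^+ 2) =
    k%:R * (1 + k%:R * D ^+ 2).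
  transitivity (\sum_(j < k) (1 + k%:R * D ^+ 2)).
    apply: eq_bigr => j _; rewrite big_split sumr_const card_ord mulr_natl.
    congr (_ + _); rewrite (bigD1 j) //= eqxx big1 ?addr0 // => l /negbTE.
    by rewrite eq_sym => ->.
  by rewrite sumr_const card_ord -[LHS]mulr_natl.
rewrite le_eqVlt; apply/orP; left; apply/eqP; field => //.
Qed.

(** Rounding up adds at most 1, which is at most [1 / c ^+ 2] because [c <= 1]; so [c] enters the
    upper bound only through that factor. *)
Lemma repetitions_bounds (R : realType) (om eps c : R) :
  0 < om -> 0 < eps -> 0 < c <= 1 ->
  let k : R := (repetitions om eps c)%:R in
  2 * om / (eps ^+ 2 * c ^+ 2) <= k /\
  k <= (2 * om * eps^-1 ^+ 2 + 1) / c ^+ 2.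
Proof.
move=> om0 eps0 /andP[c0 c1]; rewrite /repetitions; set z := _ / _.
have z0 : 0 < z by rewrite divr_gt0 ?mulr_gt0 ?exprn_gt0.
have -> /= : (`|Num.ceil z|%N)%:R = (Num.ceil z)%:~R :> R.
  by rewrite natr_absz gtr0_norm // ceil_gt0.
split; first exact: ceil_ge.
have cz : (Num.ceil z)%:~R <= z + 1.
  by have := ltW (ceilB1_lt z); rewrite intrB; lra.
apply: (le_trans cz); rewrite mulrDl.
have -> : 2 * om * eps^-1 ^+ 2 / c ^+ 2 = z.
  by rewrite /z; field; rewrite !gt_eqF.
by rewrite lerD2l mul1r invf_ge1 ?exprn_gt0 // exprn_ile1 // ltW.
Qed.

(** The mass is 1 at red and 0 at blue consensus, so it differs from the indicator of red consensus
    only while there is no consensus. *)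
Lemma consensus_mass_bounds (R : realType) n (mu : 'rV[R]_n) (s : config n) :
  (forall v, 0 <= mu 0 v) -> \sum_v mu 0 v = 1 ->
  (consensus red s)%:R <= mass mu s /\
  mass mu s <=
    (consensus red s)%:R + (1 - (consensus red s || consensus blue s)%:R).
Proof.
move=> mu0 mu1; have m0 := mass_ge0 s mu0; have m1 := mass_le1 s mu0 mu1.
have [/forallP cr|ncr] := boolP (consensus red s).
  rewrite /=; suff : mass mu s = 1 by lra.
  by rewrite -mu1 /mass; apply: eq_bigl => v; rewrite cr.
split=> //=; have [/forallP cb|ncb] /= := boolP (consensus blue s); last by lra.
suff : mass mu s = 0 by lra.
by rewrite /mass big_pred0 // => v; rewrite (eqP (cb v)).
Qed.

(** * Truncated runs and the probability of a good sample *)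

Section MonteCarlo.
Variables (R : realType) (n : nat) (E : rel 'I_n) (H : 'M[R]_n) (mu : 'rV[R]_n).
Variables (p : R) (m : update_mode) (S0 : config n).
Variables (d : measure_display) (T : measurableType d) (P : probability T R).
Variable X : nat * nat * option 'I_n -> T -> 'I_n.
Hypotheses (sc : strongly_connected E) (HE : transition_matrix E H).
Hypotheses (mu_stat : stationary_distribution H mu).
Hypotheses (p_min : smallest_nonzero_entry H p).
Hypotheses (XP : independent_draws H P X) (conv : always_converges m P X).
Hypothesis S0_red : exists v, S0 v = red.

Local Notation c := (red_consensus_probability m S0 P X).

Lemma nodes_gt0 : (0 < n)%N.
Proof. by case: S0_red => v _; apply: leq_ltn_trans (ltn_ord v). Qed.

Lemma smallest_entry_gt0 : 0 < p.
Proof.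
case: p_min => p0 [v [u Hp]] _.
by rewrite lt_def p0 -Hp (transition_ge0 HE).
Qed.

Local Notation run_Ex N := (Ex (round_weight H (N := N))).
Local Notation runs_Ex k N := (Ex (fun _ : 'I_k => @run_weight R n H N)).

(** Output of a run truncated at the horizon: if some node is still agnostic there, it is the red
    mass at round [N.+1]. *)
Definition stopped_mass N (x : run_draws n N) : R :=
  mass mu (traj m S0 x (unstopped_rounds (traj m S0 x) N.+1)).

Lemma stopped_mass_itv N (x : run_draws n N) : 0 <= stopped_mass x <= 1.
Proof. by case: mu_stat => ? ? _; rewrite mass_ge0 ?mass_le1. Qed.

(** At a late horizon, red consensus has been reached with probability near [c] and some consensus
    with probability near 1. Optional stopping and [consensus_mass_bounds] then place the mean
    output near [c]. *)
Lemma exists_horizon (eta : R) : 0 < eta ->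
  exists N, `|run_Ex N (@stopped_mass N) - c| <= eta /\
    run_Ex N (fun x => (~~ all_gnostic (traj m S0 x N.+1))%:R) <= eta.
Proof.
move=> eta0; have w0 := round_weight_ge0 HE; have w1 := round_weight_sum1 nodes_gt0 HE.
(* One half for the error on red consensus, one half for missing consensus: both enter the upper
   bound [a + (1 - b)]. *)
have eta2 : 0 < eta / 2 by rewrite divr_gt0.
have cvg_red := absorbing_event_cvg nodes_gt0 HE XP
  (m := m) (s0 := S0) (Phi := consensus red) (fun x t => @consensus_step _ _ _ _ _).
rewrite -[fine _]/c in cvg_red.
pose cons (s : config n) := consensus red s || consensus blue s.
have cons_abs x t : cons (trajectory m S0 x t) -> cons (trajectory m S0 x t.+1).
  by move=> /orP[] /consensus_step cs; rewrite /cons /= cs ?orbT.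
have cvg_cons := absorbing_event_cvg nodes_gt0 HE XP cons_abs.
have P1 : fine (P [set w | exists t, cons (run m S0 X 0 w t)]) = 1.
  have S0g : exists v, gnostic (S0 v) by case: S0_red => v e; exists v; rewrite e.
  rewrite -[RHS]/(fine 1%E) -(conv S0g); congr (fine (P _)).
  by apply/seteqP; split => w /= -[t /orP ct]; exists t.
rewrite P1 in cvg_cons.
have near_red := (cvgrPdist_le _ _).1 cvg_red _ eta2.
have near_cons := (cvgrPdist_le _ _).1 cvg_cons _ eta2.
have [N] := filter_ex (filterI (near_red _) (near_cons _)); move=> [/=].
set a := Ex _ _; set b := Ex _ _; rewrite !ler_norml => ac b1.
have [mu0 mu1 muH] := mu_stat.
have bounds (x : run_draws n N) := consensus_mass_bounds (traj m S0 x N.+1) mu0 mu1.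
have lo : a <= run_Ex N (@stopped_mass N).
  rewrite (mean_stopped_mass nodes_gt0 HE) // (le_Ex (w0 N)) // => x.
  by have [] := bounds x.
have hi : run_Ex N (@stopped_mass N) <= a + (1 - b).
  rewrite (mean_stopped_mass nodes_gt0 HE) // /a /b.
  rewrite -[X in X - _](Ex_cst (w1 N) 1) -ExB -ExD (le_Ex (w0 N)) // => x.
  by have [] := bounds x.
exists N; split; first by rewrite ler_norml; lra.
suff : run_Ex N (fun x => (~~ all_gnostic (traj m S0 x N.+1))%:R) <= 1 - b by lra.
rewrite -[X in X - _](Ex_cst (w1 N) 1) -ExB (le_Ex (w0 N)) // => x.
rewrite /cons; case: (boolP (all_gnostic _)) => [_|ng] /=.
  by rewrite subr_ge0 lern1 leq_b1.
have nc z : consensus (Some z) (traj m S0 x N.+1) = false.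
  by apply: contraNF ng; apply: consensus_all_gnostic.
by rewrite /red /blue !nc subr0.
Qed.

(** Up to any [e], [c] is the mean stopped mass at some horizon. That mean is at most 1 and at least
    the initial red mass, positive by [stationary_gt0]. *)
Lemma red_consensus_probability_itv : 0 < c <= 1.
Proof.
have [mu0 mu1 muH] := mu_stat; have w1 := round_weight_sum1 nodes_gt0 HE.
have mass_gt0 : 0 < mass mu S0.
  case: S0_red => v rv; rewrite /mass (bigD1 v) ?rv //= ltr_pwDl //.
    exact: (stationary_gt0 HE).
  exact: sumr_ge0.
apply/andP; split.
  apply: (lt_le_trans mass_gt0); apply/ler_addgt0Pl => e e0.
  have [N [+ _]] := exists_horizon e0.
  rewrite (mean_stopped_mass nodes_gt0 HE) // ler_norml.
  have := mean_mass_ge nodes_gt0 HE m S0 mu_stat (leqnn N.+1).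
  lra.
apply/ler_addgt0Pl => e e0.
have [N [+ _]] := exists_horizon e0.
have : run_Ex N (@stopped_mass N) <= 1.
  rewrite -[leRHS](Ex_cst (w1 N)) (le_Ex (round_weight_ge0 HE (N := N))) //.
  by move=> x; have /andP[] := stopped_mass_itv x.
rewrite ler_norml; lra.
Qed.

Definition total_rounds k N (x : runs_draws n k N) : nat :=
  \sum_j unstopped_rounds (traj m S0 (x j)) N.+1.

Definition good_draws k N (eps B : R) (x : runs_draws n k N) : bool :=
  [&& [forall j, all_gnostic (traj m S0 (x j) N.+1)],
      (k%:R^-1 * \sum_j stopped_mass (x j) - c) ^+ 2 <= (eps * c) ^+ 2
    & (total_rounds x)%:R <= B].

(** Union bound over the three failures: a large deviation, too many rounds in total, and a run
    still going at the horizon. *)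
Lemma good_draws_probability k N (eps B eta : R) :
  (0 < k)%N -> 0 < eps -> 0 < B ->
  `|run_Ex N (@stopped_mass N) - c| <= eta ->
  run_Ex N (fun x => (~~ all_gnostic (traj m S0 x N.+1))%:R) <= eta ->
  1 - ((k%:R^-1 + eta ^+ 2) / (eps * c) ^+ 2 + k%:R * (n%:R ^+ 2 * p^-1) / B
       + k%:R * eta)
  <= runs_Ex k N (fun x => (@good_draws k N eps B x)%:R).
Proof.
move=> k0 eps0 B0 ceta neta.
have w0 := run_weight_ge0 HE (N := N); have w1 := run_weight_sum1 nodes_gt0 HE N.
have w0' (j : 'I_k) := w0; have w1' (j : 'I_k) := w1.
have /andP[c0 c1] := red_consensus_probability_itv.
pose dev (x : runs_draws n k N) : R := (k%:R^-1 * \sum_j stopped_mass (x j) - c) ^+ 2.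
have dev_le : runs_Ex k N (fun x => ((eps * c) ^+ 2 < dev x)%R%:R) <=
    (k%:R^-1 + eta ^+ 2) / (eps * c) ^+ 2.
  apply: (le_trans (Ex_markov w0' _ _)).
  - by move=> x; apply: sqr_ge0.
  - by rewrite exprn_gt0 // mulr_gt0.
  rewrite ler_wpM2r ?invr_ge0 ?sqr_ge0 //.
  apply: (le_trans (Ex_sample_mean w0 w1 k0 (@stopped_mass_itv N) _)).
    by rewrite ltW.
  rewrite lerD2l -real_normK ?num_real // ler_pXn2r ?nnegrE //.
  exact: le_trans ceta.
have rounds_le : runs_Ex k N (fun x => (B < (total_rounds x)%:R)%R%:R) <=
    k%:R * (n%:R ^+ 2 * p^-1) / B.
  apply: (le_trans (Ex_markov w0' _ _)) => //.
  rewrite ler_wpM2r ?invr_ge0 ?(ltW B0) //.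
  under eq_Ex do rewrite natr_sum.
  rewrite Ex_sum; under eq_bigr => j _ do
    rewrite (Ex_coord w1' j (fun y => (unstopped_rounds (traj m S0 y) N.+1)%:R)).
  rewrite sumr_const card_ord -[leLHS]mulr_natl ler_wpM2l //.
  have S0g : exists v, gnostic (S0 v) by case: S0_red => v e; exists v; rewrite e.
  have := mean_unstopped_rounds nodes_gt0 HE m sc p_min S0g (leqnn N.+1).
  rewrite -[Ex _ _]/(\sum_x run_weight H x * _).
  set e := \sum_x _ => bound.
  have n1 : 1 <= n%:R :> R by rewrite ler1n nodes_gt0.
  have p0 := smallest_entry_gt0.
  (* The asynchronous rate bounds both modes from below, whence [n ^ 2 / p] rounds on average in
     either mode. *)
  have r_ge : n%:R^-1 <= update_rate R m n.
    by case: m => //=; rewrite invf_le1 // ltr0n nodes_gt0.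
  have e0 : 0 <= e by apply: sumr_ge0 => x _; rewrite mulr_ge0 // w0.
  rewrite ler_pdivlMr // expr2 -ler_pdivrMl ?ltr0n ?nodes_gt0 //.
  apply: le_trans bound.
  by rewrite -(mulrA (update_rate _ _ _)) (mulrC e) ler_wpM2r // mulr_ge0 // ltW.
have stop_le : runs_Ex k N (fun x => \sum_j (~~ all_gnostic (traj m S0 (x j) N.+1))%:R) <=
    k%:R * eta.
  rewrite Ex_sum; under eq_bigr => j _ do
    rewrite (Ex_coord w1' j (fun y => (~~ all_gnostic (traj m S0 y N.+1))%:R)).
  by rewrite sumr_const card_ord -[leLHS]mulr_natl ler_wpM2l.
have -> : forall r, 1 - r <= runs_Ex k N (fun x => (@good_draws k N eps B x)%:R) =
    (runs_Ex k N (fun x => 1 - (@good_draws k N eps B x)%:R) <= r).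
  by move=> r; rewrite ExB (Ex_cst w1') lerBlDr lerBlDr addrC.
apply: le_trans (lerD (lerD dev_le rounds_le) stop_le).
rewrite -!ExD (le_Ex w0') // => x; rewrite /good_draws -/(dev x).
have sum_ge0 : 0 <= \sum_j (~~ all_gnostic (traj m S0 (x j) N.+1))%:R :> R.
  by apply: sumr_ge0.
case: forallP => [_|/forallP/forallPn[j nj]] /=.
  by rewrite !leNgt; clear w0' w1'; case: (_ < dev x); case: (B < _) => /=; lra.
rewrite subr0; apply: ler_wpDl; first by rewrite addr_ge0.
by rewrite (bigD1 j) //= nj lerDl sumr_ge0.
Qed.

End MonteCarlo.

(** * Success event and running time *)

Lemma unstopped_rounds_le n (s : nat -> config n) t :
  (unstopped_rounds s t <= t)%N.
Proof.
rewrite -[leqRHS]card_ord -sum1_card.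
by apply: leq_sum => t' _; apply: leq_b1.
Qed.

Section Outcome.
Variables (R : realType) (n : nat) (mu : 'rV[R]_n) (m : update_mode).
Variables (S0 : config n) (d : measure_display) (T : measurableType d).
Variable X : nat * nat * option 'I_n -> T -> 'I_n.

Lemma absorbing_run j w t t' : (t <= t')%N ->
  all_gnostic (run m S0 X j w t) -> all_gnostic (run m S0 X j w t').
Proof. exact: all_gnostic_trajectory. Qed.

Lemma observed_outcome k N w (j : 'I_k) :
  all_gnostic (run m S0 X j w N.+1) ->
  let s := run m S0 X j w in
  let x := observed X k N w j in
  [/\ stops_at s (rounds s), unstopped_rounds (traj m S0 x) N.+1 = rounds s
    & stopped_mass mu m S0 x = output mu s].
Proof.
move=> g s x; have st := stops_at_unstopped_rounds (@absorbing_run j w) g.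
have eqT : unstopped_rounds (traj m S0 x) N.+1 = unstopped_rounds s N.+1.
  by apply: eq_bigr => t _; rewrite observed_run // ltnW.
have rE := rounds_stops_at st; rewrite -/s in rE st.
by rewrite /stopped_mass eqT observed_run ?unstopped_rounds_le // -/s /output rE.
Qed.

End Outcome.

(** As [n + 2] bounds the draws per round in both modes, a round costs at most [(n + 2) * n + n];
    the initial test and the output add [2 * n] per run. *)
Lemma total_cost_le m n k (t : 'I_k -> nat) :
  (n ^ 3 + \sum_(j < k)
     (t j * (draws_per_round m n * n) + (t j).+1 * n + n) <=
   n ^ 3 + (\sum_(j < k) t j) * (n ^ 2 + 3 * n) + k * (2 * n))%N.
Proof.
rewrite -addnA leq_add2l big_distrl /= -[X in (_ + X * _)%N]card_ord -sum_nat_const.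
rewrite -big_split; apply: leq_sum => j _ /=.
have dpr : (draws_per_round m n <= n + 2)%N by case: m; rewrite /= ?leq_addr ?leq_addl.
apply: (@leq_trans (t j * ((n + 2) * n) + (t j).+1 * n + n)).
  by rewrite !leq_add2r leq_mul2l leq_mul2r dpr !orbT.
apply: eq_leq; rewrite -addn1; ring.
Qed.

Section SuccessEvent.
Variables (R : realType) (n : nat) (H : 'M[R]_n) (mu : 'rV[R]_n).
Variables (m : update_mode) (S0 : config n).
Variables (d : measure_display) (T : measurableType d) (P : probability T R).
Variable X : nat * nat * option 'I_n -> T -> 'I_n.
Hypothesis n_gt0 : (0 < n)%N.
Hypothesis XP : independent_draws H P X.
Variables (k : nat) (lo hi bound : R).

Definition simulated_cost N (x : runs_draws n k N) : nat :=
  let t j := unstopped_rounds (traj m S0 (x j)) N.+1 in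
  (n ^ 3 + \sum_(j < k)
     (t j * (draws_per_round m n * n) + (t j).+1 * n + n))%N.

Definition success N (x : runs_draws n k N) : bool :=
  [&& [forall j, all_gnostic (traj m S0 (x j) N.+1)],
      lo <= k%:R^-1 * \sum_j stopped_mass mu m S0 (x j) <= hi
    & (simulated_cost x)%:R <= bound].

(* Once every run has stopped before a common horizon, the outcome of the
   algorithm is a function of the finitely many draws up to that horizon. *)
Lemma success_event :
  [set w | [/\ forall j, (j < k)%N -> exists t, stops_at (run m S0 X j w) t,
      lo <= estimate mu k (fun j => run m S0 X j w) <= hi
    & (total_cost m k (fun j => run m S0 X j w))%:R <= bound]] =
  \bigcup_N [set w | success (observed X k N w)].
Proof.
have outcome N w : (forall j : 'I_k, all_gnostic (run m S0 X j w N.+1)) ->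
    estimate mu k (fun j => run m S0 X j w) =
      k%:R^-1 * \sum_j stopped_mass mu m S0 (observed X k N w j) /\
    total_cost m k (fun j => run m S0 X j w) = simulated_cost (observed X k N w).
  move=> g; split.
    congr (_ * _); apply: eq_bigr => j _.
    by have [_ _ ->] := observed_outcome mu (g j).
  congr (_ + _)%N; apply: eq_bigr => j _.
  by have [_ -> _] := observed_outcome mu (g j).
have observed_gnostic N w : [forall j, all_gnostic (traj m S0 (observed X k N w j) N.+1)] =
    [forall j : 'I_k, all_gnostic (run m S0 X j w N.+1)].
  by apply: eq_forallb => j; rewrite observed_run.
apply/seteqP; split => w /=.
  case=> stop est cost.
  have [N gN] : exists N, forall j, (j < k)%N -> all_gnostic (run m S0 X j w N).
    elim: (k) stop => [|k' IH] stop; first by exists 0%N.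
    have [|N gN] := IH; first by move=> j jk; apply: stop; apply: ltnW.
    have [t [gt _]] := stop k' (ltnSn k').
    exists (maxn N t) => j; rewrite ltnS leq_eqVlt => /orP[/eqP->|/gN].
      exact: absorbing_run (leq_maxr _ _) gt.
    exact: absorbing_run (leq_maxl _ _).
  exists N => //=; rewrite /success observed_gnostic.
  have g (j : 'I_k) : all_gnostic (run m S0 X j w N.+1).
    exact: absorbing_run (leqnSn N) (gN j (ltn_ord j)).
  have [<- <-] := outcome N w g; rewrite est cost !andbT.
  exact/forallP.
case=> N _; rewrite /= /success observed_gnostic => /and3P[/forallP g est cost].
have [-> ->] := outcome N w g; split=> // j jk.
by have [st _ _] := observed_outcome mu (g (Ordinal jk)); exists (rounds (run m S0 X j w)).
Qed.

(** The cylinder event at the single horizon [N] lies inside the union of [success_event]. *)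
Lemma success_probability N (Phi : pred (runs_draws n k N)) :
  (forall x, Phi x -> success x) ->
  ((Ex (fun _ : 'I_k => @run_weight R n H N) (fun x => (Phi x)%:R))%:E <=
   P [set w | [/\ forall j, (j < k)%N -> exists t, stops_at (run m S0 X j w) t,
      (lo <= estimate mu k (fun j => run m S0 X j w) <= hi)%R
    & ((total_cost m k (fun j => run m S0 X j w))%:R <= bound)%R]])%E.
Proof.
move=> PhiS; have [mPhi <-] := observed_event n_gt0 XP Phi.
rewrite success_event; apply: le_measure; rewrite ?inE //.
  apply: bigcup_measurable => N' _.
  by have [] := observed_event n_gt0 XP (@success N').
by move=> w Phiw; exists N => //; apply: PhiS.
Qed.

End SuccessEvent.

(** Here [x] is [n], [y] is [1 / eps] and [z] is [omega n]. The factor [2 * z * y ^+ 2 + 1] bounds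
    [k * c ^+ 2]; the bracket is [x ^+ 2 * q * z] rounds at [x ^+ 2 + 3 * x] each, plus the fixed
    cost of a run. *)
Definition running_time_poly (R : realType) (q : {poly R}) :
    {poly {poly {poly R}}} :=
  let x := 'X in let y := 'X%:P in let z := 'X%:P%:P in
  x ^+ 3 + (2 * z * y ^+ 2 + 1) *
    (x ^+ 2 * map_poly (polyC \o polyC) q * z * (x ^+ 2 + 3 * x) + 2 * x).

Lemma eval3_running_time_poly (R : realType) (q : {poly R}) (x y z : R) :
  eval3 (running_time_poly q) x y z =
  x ^+ 3 + (2 * z * y ^+ 2 + 1) *
    (x ^+ 2 * q.[x] * z * (x ^+ 2 + 3 * x) + 2 * x).
Proof.
rewrite /eval3 /running_time_poly.
have qE : (map_poly (polyC \o polyC) q).[x%:P%:P] = (q.[x])%:P%:P.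
  exact: (horner_map (polyC \o polyC)).
rewrite !(hornerD, hornerM, horner_exp, hornerX) qE.
rewrite !(hornerD, hornerM, horner_exp, hornerX, hornerC).
by ring.
Qed.

(* Chebyshev contributes [1 / (2 om)], Markov [1 / om], and the truncation at
   the horizon the two terms in [eta]. *)
Lemma failure_le (R : realType) (k n : nat) (om eps c q p eta delta : R) :
  (0 < k)%N -> (0 < n)%N -> 1 <= om -> 3 / delta <= om -> 0 < delta ->
  0 < eps * c -> 2 * om / (eps * c) ^+ 2 <= k%:R ->
  0 < p -> p^-1 <= q -> 0 <= eta <= 1 ->
  eta <= delta / 4 * (eps * c) ^+ 2 -> eta <= delta / 4 / k%:R ->
  (k%:R^-1 + eta ^+ 2) / (eps * c) ^+ 2 +
  k%:R * (n%:R ^+ 2 * p^-1) / (k%:R * (n%:R ^+ 2 * q * om)) + k%:R * eta <= delta.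
Proof.
move=> k0 n0 om1 om3 d0; set e := (eps * c) ^+ 2 => ec k_ge p0 pq /andP[eta0 eta1] eta_e eta_k.
have e0 : 0 < e by rewrite exprn_gt0.
have om0 : 0 < om by lra.
have kR : 0 < k%:R :> R by rewrite ltr0n.
have nR : 0 < n%:R :> R by rewrite ltr0n.
have q0 : 0 < q by apply: lt_le_trans pq; rewrite invr_gt0.
have omV : om^-1 <= delta / 3.
  by rewrite -[leRHS]invrK lef_pV2 ?posrE ?invr_gt0 ?divr_gt0 // invf_div.
have t1 : k%:R^-1 / e <= om^-1 / 2.
  rewrite -invfM -[leRHS]invfM lef_pV2 ?posrE ?(mulr_gt0 kR e0) ?(mulr_gt0 om0) //.
  by rewrite (mulrC om) -ler_pdivrMr.
have t2 : eta ^+ 2 / e <= delta / 4.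
  rewrite ler_pdivrMr //; apply: le_trans eta_e.
  by rewrite expr2 -[leRHS]mulr1 ler_wpM2l.
have t3 : k%:R * eta <= delta / 4 by rewrite mulrC -ler_pdivlMr.
have t4 : k%:R * (n%:R ^+ 2 * p^-1) / (k%:R * (n%:R ^+ 2 * q * om)) <= om^-1.
  rewrite ler_pdivrMr ?mulr_gt0 ?exprn_gt0 //.
  have -> : om^-1 * (k%:R * (n%:R ^+ 2 * q * om)) = k%:R * (n%:R ^+ 2 * q).
    by field; rewrite gt_eqF.
  by rewrite !ler_pM2l ?exprn_gt0.
(* The four terms are at most [delta / 6], [delta / 4], [delta / 3] and [delta / 4], which add up to
   [delta]. *)
rewrite mulrDl; lra.
Qed.

Lemma simulated_cost_le (R : realType) n k N m (S0 : config n)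
    (x : runs_draws n k N) (B : R) : (total_rounds m S0 x)%:R <= B ->
  (simulated_cost m S0 x)%:R <=
  n%:R ^+ 3 + B * (n%:R ^+ 2 + 3 * n%:R) + k%:R * (2 * n%:R).
Proof.
move=> xB; apply: (@le_trans _ _ (n%:R ^+ 3 +
    (total_rounds m S0 x)%:R * (n%:R ^+ 2 + 3 * n%:R) + k%:R * (2 * n%:R))).
  rewrite -!(natrX, natrM, natrD) ler_nat.
  exact: (total_cost_le m n (fun j => unstopped_rounds (traj m S0 (x j)) N.+1)).
by rewrite lerD2r lerD2l ler_wpM2r // addr_ge0 // mulr_ge0.
Qed.

Lemma cost_le_running_time (R : realType) (q : {poly R}) (x eps om c k : R) :
  0 <= x -> 0 <= q.[x] -> 0 <= om -> 0 < c <= 1 ->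
  k <= (2 * om * eps^-1 ^+ 2 + 1) / c ^+ 2 ->
  x ^+ 3 + k * (x ^+ 2 * q.[x] * om) * (x ^+ 2 + 3 * x) + k * (2 * x) <=
  eval3 (running_time_poly q) x eps^-1 om / c ^+ 2.
Proof.
move=> x0 q0 om0 /andP[c0 c1] kle; rewrite eval3_running_time_poly [leRHS]mulrDl.
(* The cost of computing [mu] has no factor [k]; [c <= 1] lets it be divided by [c ^+ 2] as well. *)
rewrite -addrA lerD //.
  rewrite ler_pdivlMr ?exprn_gt0 // -[leRHS]mulr1 ler_wpM2l ?exprn_ge0 //.
  by rewrite exprn_ile1 // ltW.
rewrite -[k * _ * _]mulrA -[leLHS]mulrDr [leRHS]mulrAC ler_wpM2r //.
by rewrite addr_ge0 // !mulr_ge0 ?addr_ge0 ?mulr_ge0 ?exprn_ge0.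
Qed.

Theorem theorem7 (R : realType) (q : {poly R}) :
  exists Q : {poly {poly {poly R}}},
  forall omega : nat -> R, omega n @[n --> \oo] --> +oo ->
  forall eps : R, 0 < eps ->
  forall delta : R, 0 < delta ->
  \forall n \near \oo,
  forall (E : rel 'I_n) (H : 'M[R]_n) (mu : 'rV[R]_n) (p : R)
    (m : update_mode) (S0 : config n)
    (d : measure_display) (T : measurableType d) (P : probability T R)
    (X : nat * nat * option 'I_n -> T -> 'I_n),
  strongly_connected E ->
  transition_matrix E H ->
  stationary_distribution H mu ->
  smallest_nonzero_entry H p ->
  p^-1 <= q.[n%:R] ->
  independent_draws H P X ->
  always_converges m P X ->
  (exists v, S0 v = red) ->
  let c := red_consensus_probability m S0 P X in
  let k := repetitions (omega n) eps c in
  let cbar w := estimate mu k (fun j => run m S0 X j w) in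
  let cost w := total_cost m k (fun j => run m S0 X j w) in
  let good : set T := [set w |
    [/\ forall j, (j < k)%N -> exists t, stops_at (run m S0 X j w) t,
        (1 - eps) * c <= cbar w <= (1 + eps) * c
      & (cost w)%:R <= eval3 Q n%:R eps^-1 (omega n) / c ^+ 2]] in
  0 < c /\ (P good >= (1 - delta)%:E)%E.
Proof.
exists (running_time_poly q) => omega /cvgryPge om_oo eps eps0 delta delta0.
(* The threshold on [n] depends only on [omega] and [delta], hence is uniform over instances. The
   horizon below may depend on the instance. *)
apply: filterS (om_oo (Num.max 1 (3 / delta))) => n.
rewrite ge_max => /andP[om1 om3] E H mu p m S0 d T P X sc HE mu_stat p_min pq XP conv S0_red.
have om0 : 0 < omega n by lra.
have n0 := nodes_gt0 S0_red.
have p0 := smallest_entry_gt0 HE p_min.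
have q0 : 0 < q.[n%:R] by apply: lt_le_trans pq; rewrite invr_gt0.
have c01 := red_consensus_probability_itv sc HE mu_stat XP conv S0_red.
set c := red_consensus_probability m S0 P X; set k := repetitions _ _ c.
have /andP[c0 c1] : 0 < c <= 1 := c01; split=> //.
have [k_ge k_le] := repetitions_bounds om0 eps0 c01.
rewrite -exprMn -/c -/k in k_ge k_le.
have e0 : 0 < (eps * c) ^+ 2 by rewrite exprn_gt0 // mulr_gt0.
have kR : 0 < k%:R :> R by apply: lt_le_trans k_ge; rewrite divr_gt0 // mulr_gt0.
have k0 : (0 < k)%N by rewrite ltr0n in kR.
(* The bound 1 gives [eta ^+ 2 <= eta], the second controls the bias in Chebyshev's inequality, the
   third the chance that one of [k] runs is unfinished. *)
pose eta : R := Num.min 1 (Num.min (delta / 4 * (eps * c) ^+ 2) (delta / 4 / k%:R)).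
have eta0 : 0 < eta by rewrite !lt_min ltr01 !(mulr_gt0, invr_gt0).
have [eta1 eta_e eta_k] :
    [/\ eta <= 1, eta <= delta / 4 * (eps * c) ^+ 2 & eta <= delta / 4 / k%:R].
  by split; rewrite !ge_min lexx ?orbT.
have [N [ceta neta]] := exists_horizon HE mu_stat XP conv S0_red eta0.
(* [omega n] times a bound on the mean total number of rounds, so that Markov's inequality fails
   with probability at most [1 / omega n]. *)
pose B : R := k%:R * (n%:R ^+ 2 * q.[n%:R] * omega n).
have B0 : 0 < B by rewrite !mulr_gt0 ?exprn_gt0 ?ltr0n.
have prob := good_draws_probability sc HE mu_stat p_min XP conv S0_red k0 eps0 B0 ceta neta.
apply: (@le_trans _ _ (Ex (fun _ : 'I_k => @run_weight R n H N)
   (fun x => (@good_draws R n mu m S0 d T P X k N eps B x)%:R))%:E).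
  rewrite lee_fin; apply: le_trans prob; rewrite lerD2l lerN2.
  by apply: failure_le; rewrite ?mulr_gt0 // ltW.
apply: (success_probability n0 XP (Phi := @good_draws R n mu m S0 d T P X k N eps B)).
move=> x /and3P[stop dev rounds]; apply/and3P; split=> //.
  move: dev; rewrite -ler_sqrt ?sqr_ge0 // !sqrtr_sqr (gtr0_norm (mulr_gt0 eps0 c0)).
  rewrite ler_norml -/c => dev; lra.
apply: le_trans (simulated_cost_le rounds) _.
by apply: cost_le_running_time => //; apply: ltW.
Qed.
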